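(* Let $n\ge 1$ and $1\le p\le n$ be integers. The number of $p$-toppleable configurations in $\mathcal{S}(n,p)$ equals $\tfrac12 B_{n-p+1,p}$.
   Context: Sites are the integers $0,1,\dots,n+1$. A configuration in $\mathcal{S}(n,p)$ is a placement of $n+1$ distinct chips labeled $1,\dots,n+1$ such that sites $0$ and $n+1$ are empty, every site $i\in\{1,\dots,n\}\setminus\{p\}$ holds exactly one chip, and site $p$ holds exactly two chips. Toppling: while some site holds at least two chips, choose such a site $i$ and two chips $\alpha<\beta$ at site $i$, and move $\alpha$ to site $i-1$ and $\beta$ to site $i+1$. It is known that this process terminates with all chips in sites $0,\dots,n+1$, every site holding at most one chip (so exactly one site is empty), and that the final configuration does not depend on the choices made. Reading the chip labels of the final configuration from left to right gives a permutation of $[n+1]$; a configuration is $p$-toppleable if this permutation is the identity $12\cdots(n+1)$. The poly-Bernoulli numbers of type B, $B_{n,k}$ ($n,k\ge 0$), are defined by $\sum_{n\ge 0}B_{n,k}\frac{x^n}{n!}=\frac{\mathrm{Li}_{-k}(1-e^{-x})}{1-e^{-x}}$, where $\mathrm{Li}_s(z)=\sum_{i\ge1}z^i/i^s$; equivalently $B_{n,k}=\sum_{m=0}^{\min(n,k)}(m!)^2\left\{{n+1\atop m+1}\right\}\left\{{k+1\atop m+1}\right\}$ with Stirling numbers of the second kind. *)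

(* Defs.v *)
From mathcomp Require Import all_boot all_order all_algebra.
From Stdlib Require Import Relations.
Set Implicit Arguments. Unset Strict Implicit. Unset Printing Implicit Defensive.
Import Order.TTheory GRing.Theory Num.Theory.

Fixpoint stirling2 (n k : nat) : nat :=
  match n, k with
  | 0, 0 => 1
  | 0, _.+1 => 0
  | _.+1, 0 => 0
  | n'.+1, k'.+1 => k'.+1 * stirling2 n' k'.+1 + stirling2 n' k'
  end.

Definition polyBernB (n k : nat) : nat :=
  \sum_(0 <= m < (minn n k).+1)
     (m`! ^ 2 * stirling2 n.+1 m.+1 * stirling2 k.+1 m.+1)%N.

(* Chips 1..n+1 are represented by ordinals a : 'I_(n+1) (chip a+1);
   the order on chip labels is the order on ordinals.
   A (general) chip configuration assigns to each chip an integer site. *)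
Definition chipconf (n : nat) := {ffun 'I_n.+1 -> int}.

Definition topple_step (n : nat) (c c' : chipconf n) : Prop :=
  exists (i : int) (a b : 'I_n.+1),
    (a < b)%N /\ c a = i /\ c b = i /\
    c' = [ffun x => if x == a then (i - 1)%R
                    else if x == b then (i + 1)%R else c x].

Definition stable (n : nat) (c : chipconf n) : bool := injectiveb c.

Definition reading (n : nat) (c : chipconf n) : seq 'I_n.+1 :=
  sort (fun a b => (c a <= c b)%R) (enum 'I_n.+1).

Definition in_S (n p : nat) (c0 : {ffun 'I_n.+1 -> 'I_n.+2}) : Prop :=
  forall s : 'I_n.+2,
    #|[set x | c0 x == s]| =
      (if (s == 0 :> nat) || (s == n.+1 :> nat) then 0
       else if s == p :> nat then 2 else 1)%N.

Definition embed (n : nat) (c0 : {ffun 'I_n.+1 -> 'I_n.+2}) : chipconf n :=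
  [ffun x => Posz (c0 x : nat)].

(* p-toppleable: toppling terminates in a stable configuration whose reading
   is the identity permutation 1 2 ... (n+1). (The final configuration is
   independent of the choices made.) *)
Definition toppleable (n : nat) (c0 : {ffun 'I_n.+1 -> 'I_n.+2}) : Prop :=
  exists cf : chipconf n,
    clos_refl_trans _ (@topple_step n) (embed c0) cf /\
    stable cf /\ reading cf = enum 'I_n.+1.

(* Main.v *)
Require Import Defs.
From mathcomp Require Import all_boot all_order all_algebra.
From Stdlib Require Import Relation_Operators.
From mathcomp Require Import zify.

(* Let q = n + 1 - p.  Any sequence of topplings runs through the cells of a
   p x q grid of comparators: the two chips meeting at the cell (a, b) are the
   current chips of row a and of column b, and toppling puts the larger one on
   the row and the smaller one on the column.  The condition "column b carries a
   chip >= b and row a carries a chip <= n - a" (chips numbered from 0) is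
   invariant, in both directions, under toppling, and when all cells have been
   used every row chip exceeds every column chip, so that the condition then says
   that the chips are sorted.  Hence, without any appeal to confluence, a
   configuration is toppleable iff it satisfies the condition initially.

   Numbering the chips by the lines they end on, such initial labelings are the
   permutations of 'I_q + 'I_p whose two diagonal blocks are rook placements on
   staircase boards; the off-diagonal blocks are unrestricted.  If m entries lie
   in each off-diagonal block, these can be chosen in m!^2 ways, and the
   staircase of size q carries S(q+1, m+1) placements of q - m rooks.  Exchanging
   the two chips at site p gives the factor 2. *)

Set Implicit Arguments.
Unset Strict Implicit.
Unset Printing Implicit Defensive.

(** * The comparator grid *)

(* The rows carry the chips that start at the sites p, p-1, ..., 1, and the
   columns those that start at p, p+1, ..., n.  A toppling at the cell (a, b)
   sends the smaller chip one site to the left, along column b, and the larger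
   one to the right, along row a; l a and l' b count the cells already used on
   each line, i.e. the row and column lengths of a partition inside p x q. *)
Record grid_state n p q (c : chipconf n) (f : 'I_q + 'I_p -> 'I_n.+1)
    (l : 'I_p -> nat) (l' : 'I_q -> nat) : Prop := GridState {
  gs_inj : injective f;
  gs_row_le : forall a, l a <= q;
  gs_col_le : forall b, l' b <= p;
  gs_galois : forall (a : 'I_p) (b : 'I_q), (b < l a) = (a < l' b);
  gs_row : forall a, c (f (inr a)) = Posz (p + l a - a);
  gs_col : forall b, c (f (inl b)) = Posz (p + b - l' b);
  gs_lt : forall (a : 'I_p) (b : 'I_q), b < l a -> f (inl b) < f (inr a) }.

(* In the sorted final configuration column b carries the chip b and row a the
   chip n - a. *)
Definition sortable n p q (f : 'I_q + 'I_p -> 'I_n.+1) : Prop :=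
  (forall b : 'I_q, b <= f (inl b)) /\ (forall a : 'I_p, f (inr a) + a <= n).

Lemma line_surj n p q (f : 'I_q + 'I_p -> 'I_n.+1) :
  p + q = n.+1 -> injective f -> forall x, exists t, x = f t.
Proof.
move=> pq f_inj x; apply/codomP/inj_card_onto => //.
by rewrite card_sum !card_ord addnC pq.
Qed.

(** By [gs_galois], [l] and [l'] are conjugate partitions, so sites strictly decrease along the rows
    and strictly increase along the columns. A collision therefore joins a row and a column with
    [l a + l' b = a + b]. Since [b < l a] iff [a < l' b], both terms must be equalities: the cell
    [(a, b)] is an addable corner. *)
Lemma grid_state_collision n p q (c : chipconf n) f l l' t u :
  @grid_state n p q c f l l' -> t != u -> c (f t) = c (f u) ->
  exists (a : 'I_p) (b : 'I_q), [/\ l a = b, l' b = a &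
    (t = inl b /\ u = inr a) \/ (t = inr a /\ u = inl b)].
Proof.
move=> [_ lq lp gal row col _].
have rr (a a' : 'I_p) : a < a' -> c (f (inr a)) <> c (f (inr a')).
  move=> aa'; rewrite !row => -[E].
  have ? := ltn_ord a; have ? := ltn_ord a'; have ? := lq a'.
  have lt_la : l a < q by lia.
  by have := gal a (Ordinal lt_la); have := gal a' (Ordinal lt_la); rewrite /=; lia.
have cc (b b' : 'I_q) : b < b' -> c (f (inl b)) <> c (f (inl b')).
  move=> bb'; rewrite !col => -[E].
  have ? := ltn_ord b; have ? := ltn_ord b'; have ? := lp b; have ? := lp b'.
  have lt_lb : l' b < p by lia.
  by have := gal (Ordinal lt_lb) b; have := gal (Ordinal lt_lb) b'; rewrite /=; lia.
have rc (a : 'I_p) (b : 'I_q) : c (f (inr a)) = c (f (inl b)) -> l a = b /\ l' b = a.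
  rewrite row col => -[E]; have := gal a b; have := lp b; have := ltn_ord a.
  by lia.
case: t u => [b|a] [b'|a'] ne E.
- have neb : b != b' :> nat by apply: contra ne => /eqP/val_inj->.
  by case: (ltngtP b b') neb => // /cc []; rewrite E.
- by have [? ?] := rc a' b (esym E); exists a', b; split=> //; left.
- by have [? ?] := rc a b' E; exists a, b'; split=> //; right.
- have nea : a != a' :> nat by apply: contra ne => /eqP/val_inj->.
  by case: (ltngtP a a') nea => // /rr []; rewrite E.
Qed.

(** The toppling is the comparator at the corner [(a, b)], which becomes a used cell. The chip on a
    column can only decrease and the chip on a row can only increase, so the inequalities at the
    cells already used persist. *)
Lemma grid_state_step n p q (c c' : chipconf n) (f : 'I_q + 'I_p -> 'I_n.+1) l l' :
  p + q = n.+1 -> grid_state c f l l' -> topple_step c c' ->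
  exists (f1 : 'I_q + 'I_p -> 'I_n.+1) l1 l1',
    [/\ grid_state c' f1 l1 l1', sortable f <-> sortable f1 &
    \sum_a l1 a = (\sum_a l a).+1].
Proof.
move=> pq st [i [x [y [xy [cx [cy ->]]]]]].
have [f_inj lq lp gal row col flt] := st.
have [t Et] := line_surj pq f_inj x; have [u Eu] := line_surj pq f_inj y.
have tu : t != u by apply/eqP=> E; move: xy; rewrite Et Eu E ltnn.
have [|a [b [lab lba tuE]]] := grid_state_collision st tu.
  by rewrite -Et -Eu cx cy.
pose f1 s := if s == inl b then x else if s == inr a then y else f s.
have fb : (f (inl b) = x /\ f (inr a) = y) \/ (f (inl b) = y /\ f (inr a) = x).
  by case: tuE => -[tE uE]; [left|right]; rewrite Et Eu tE uE.
have f1b : f1 (inl b) = x by rewrite /f1 eqxx.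
have f1a : f1 (inr a) = y by rewrite /f1 eqxx.
have f1inl b' : b' != b -> f1 (inl b') = f (inl b').
  by move=> ne; rewrite /f1 /= (inj_eq inl_inj) (negPf ne).
have f1inr a' : a' != a -> f1 (inr a') = f (inr a').
  by move=> ne; rewrite /f1 /= (inj_eq inr_inj) (negPf ne).
have nx s : s != inl b -> s != inr a -> (f s != x) && (f s != y).
  move=> s1 s2; case: fb => -[<- <-]; rewrite !(inj_eq f_inj) s1 s2 //.
have f1E s : s != inl b -> s != inr a -> f1 s = f s.
  by rewrite /f1 => /negPf-> /negPf->.
have xney : x != y by rewrite -val_eqE /= neq_ltn xy.
exists f1, (fun a' => l a' + (a' == a)), (fun b' => l' b' + (b' == b)); split.
- split.
  + have f1P s : [\/ s = inl b /\ f1 s = x, s = inr a /\ f1 s = y |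
        [/\ f1 s = f s, f s != x & f s != y]].
      have [->|s1] := eqVneq s (inl b); first by constructor 1.
      have [->|s2] := eqVneq s (inr a); first by constructor 2.
      by constructor 3; have /andP[? ?] := nx s s1 s2; rewrite f1E.
    move=> s s'; case: (f1P s) => [[-> ->]|[-> ->]|[-> n1 n2]];
    case: (f1P s') => [[-> ->]|[-> ->]|[-> m1 m2]] // E.
    all: try by move: xney; rewrite E eqxx.
    all: try by move: m1 m2; rewrite -E eqxx.
    all: try by move: n1 n2; rewrite E eqxx.
    exact: f_inj.
  + move=> a'; have := lq a'; case: eqP => [->|_]; have := ltn_ord b; lia.
  + move=> b'; have := lp b'; case: eqP => [->|_]; have := ltn_ord a; lia.
  + move=> a' b'; have := gal a' b'.
    case: (eqVneq a' a) => [->|na]; case: (eqVneq b' b) => [->|nb];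
    rewrite /= ?addn0 //; try lia.
    * by move: nb; rewrite -val_eqE /=; lia.
    * by move: na; rewrite -val_eqE /=; lia.
  + move=> a'; rewrite ffunE; case: (eqVneq a' a) => [->|na].
      rewrite f1a eq_sym (negPf xney) eqxx -cy.
      have := ltn_ord a; have : c y = c (f (inr a)) by case: fb => -[_ ->]; rewrite ?cx ?cy.
      by rewrite row; lia.
    rewrite f1inr //.
    have /andP[/negPf-> /negPf->] := nx (inr a') isT na.
    by rewrite row addn0.
  + move=> b'; rewrite ffunE; case: (eqVneq b' b) => [->|nb].
      rewrite f1b eqxx -cx.
      have := ltn_ord a; have : c x = c (f (inl b)) by case: fb => -[-> _]; rewrite ?cx ?cy.
      by rewrite col; lia.
    rewrite f1inl //.
    have /andP[/negPf-> /negPf->] := nx (inl b') nb isT.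
    by rewrite col addn0.
  + move=> a' b'; case: (eqVneq a' a) => [->|na]; case: (eqVneq b' b) => [->|nb].
    * by rewrite f1a f1b.
    * rewrite f1a f1inl // => bl.
      have /flt : b' < l a by move: nb; rewrite -val_eqE /=; lia.
      by case: fb => -[_ ->] // h; apply: ltn_trans xy.
    * rewrite f1b f1inr // addn0 => /flt.
      by case: fb => -[-> _] //; apply: ltn_trans xy.
    * by rewrite f1inl // f1inr // addn0 => /flt.
- split=> -[h1 h2].
    (* The cell (a.-1, b) was used earlier, so the chip on column b lies below
       the one on row a.-1; dually for the cell (a, b.-1). *)
    have yle : y + a <= n.
      have [fa|/eqP] : f (inr a) = y \/ f (inl b) = y by case: fb => -[]; auto.
        by rewrite -fa.
      move/eqP=> fb'; case: (posnP a) => [->|a0]; first by have := ltn_ord y; lia.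
      have a1 : a.-1 < p by have := ltn_ord a; lia.
      have /flt : b < l (Ordinal a1) by rewrite gal /=; lia.
      by have := h2 (Ordinal a1); rewrite /= -fb'; lia.
    have xle : b <= x.
      have [fb'|fa] : f (inl b) = x \/ f (inr a) = x by case: fb => -[]; auto.
        by rewrite -fb'.
      case: (posnP b) => [->//|b0].
      have b1 : b.-1 < q by have := ltn_ord b; lia.
      have /flt : Ordinal b1 < l a by rewrite /=; lia.
      by have := h1 (Ordinal b1); rewrite /= -fa; lia.
    split=> [b'|a'].
      by have [->|nb] := eqVneq b' b; rewrite ?f1b ?f1inl.
    by have [->|na] := eqVneq a' a; rewrite ?f1a ?f1inr.
  (* Conversely, since [x < y], both [x] and [y] are at least [b] and at most [n - a], whichever of
     them was on column [b] before the toppling. *)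
  have := h1 b; have := h2 a; rewrite f1a f1b => ya bx.
  split=> [b'|a'].
    have [->|nb] := eqVneq b' b; last by rewrite -f1inl.
    by case: fb => -[-> _]; lia.
  have [->|na] := eqVneq a' a; last by rewrite -f1inr.
  by case: fb => -[_ ->]; lia.
- rewrite big_split /= -[RHS]addn1; congr (_ + _).
  by rewrite (bigD1 a) //= eqxx big1 // => j /negPf->.
Qed.

Lemma grid_state_terminates n p q (c : chipconf n)
    (f : 'I_q + 'I_p -> 'I_n.+1) l l' :
  p + q = n.+1 -> grid_state c f l l' ->
  exists cf (f1 : 'I_q + 'I_p -> 'I_n.+1) l1 l1',
    [/\ clos_refl_trans _ (@topple_step n) c cf, stable cf &
        grid_state cf f1 l1 l1'].
Proof.
move=> pq; have [N leN] : exists N, p * q - \sum_a l a <= N by exists (p * q - \sum_a l a).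
elim: N c f l l' leN => [|N IH] c f l l' leN st.
all: have [sc|/injectivePn[x [y xy E]]] := boolP (stable c);
  first by exists c, f, l, l'; split=> //; exact: rt_refl.
all: have [z [w [zw [cz cw]]]] :
    exists z w : 'I_n.+1, z < w /\ (c z = c x /\ c w = c x)
  by (case: (ltngtP x y) xy => [lt_xy|lt_yx|/val_inj->] xy; rewrite ?eqxx // in xy;
      [exists x, y|exists y, x]).
all: pose c' : chipconf n := [ffun t => if t == z then (c x - 1)%R
  else if t == w then (c x + 1)%R else c t].
all: have step : topple_step c c' by exists (c x), z, w.
all: have [f1 [l1 [l1' [st1 _ sum1]]]] := grid_state_step pq st step.
all: have le_pq : \sum_a l1 a <= p * q
  by rewrite -[p in p * q]card_ord -sum_nat_const; apply: leq_sum => a _;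
     exact: (gs_row_le st1).
- by move: leN; rewrite leqn0 subn_eq0 => /(leq_trans le_pq); rewrite sum1 ltnn.
have [|cf [f2 [l2 [l2' [path scf st2]]]]] := IH _ _ _ _ _ st1.
  by rewrite sum1 subnS -ltnS (leq_trans _ leN) // prednK // subn_gt0 -sum1.
exists cf, f2, l2, l2'; split=> //.
exact: (rt_trans _ _ _ c' _ (rt_step _ _ _ _ step) path).
Qed.

Lemma grid_state_reachable n p q (c c' : chipconf n)
    (f : 'I_q + 'I_p -> 'I_n.+1) l l' :
  p + q = n.+1 -> grid_state c f l l' ->
  clos_refl_trans _ (@topple_step n) c c' ->
  exists (f1 : 'I_q + 'I_p -> 'I_n.+1) l1 l1',
    grid_state c' f1 l1 l1' /\ (sortable f <-> sortable f1).
Proof.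
move=> pq st path; elim: path f l l' st => {c c'} [c c' step|c|c c1 c' _ IH1 _ IH2] f l l' st.
- by have [f1 [l1 [l1' [st1 sf _]]]] := grid_state_step pq st step; exists f1, l1, l1'.
- by exists f, l, l'.
have [f1 [l1 [l1' [st1 sf1]]]] := IH1 _ _ _ st.
have [f2 [l2 [l2' [st2 sf2]]]] := IH2 _ _ _ st1.
by exists f2, l2, l2'; split=> //; rewrite sf1.
Qed.

(** If row [k] were the first incomplete one, column [l a] would have met exactly the [k] full rows
    before it. The chips of row [k] and of that column would then share a site, against
    stability. *)
Lemma grid_state_stable n p q (c : chipconf n)
    (f : 'I_q + 'I_p -> 'I_n.+1) l l' :
  grid_state c f l l' -> stable c ->
  (forall a, l a = q) /\ (forall b, l' b = p).
Proof.
move=> [f_inj lq lp gal row col _] /injectiveP c_inj.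
have full k (kp : k < p) : l (Ordinal kp) = q.
  elim/ltn_ind: k kp => k IH kp; set a := Ordinal kp.
  have := lq a; rewrite leq_eqVlt => /orP[/eqP//|lt_la].
  have l'k : l' (Ordinal lt_la) = k.
    apply/eqP; rewrite eqn_leq leqNgt -(gal a) ltnn /=.
    case: k IH kp @a lt_la => // k IH kp a lt_la.
    by rewrite -[k]/(nat_of_ord (Ordinal (ltnW kp))) -gal IH.
  have : f (inr a) = f (inl (Ordinal lt_la)).
    by apply: c_inj; rewrite row col l'k.
  by move/f_inj.
have fl a : l a = q by case: a => k kp; exact: full.
split=> // b; apply/eqP; rewrite eqn_leq lp /=.
case: p f l l' f_inj lq lp gal row col full fl => // p f l l' _ _ _ gal _ _ _ fl.
by rewrite -[p]/(nat_of_ord (@ord_max p)) -gal fl.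
Qed.

(** Chip [k < q] is not on a row, where it would exceed the chip of column [k], which is at least
    [k]. So it lies on a column [b <= k], and by induction the columns before [k] hold smaller
    chips. The rows are treated dually, from chip [n] downwards. *)
Lemma sortable_order n p q (f : 'I_q + 'I_p -> 'I_n.+1) :
  p + q = n.+1 -> injective f -> sortable f ->
  (forall (b : 'I_q) (a : 'I_p), f (inl b) < f (inr a)) ->
  (forall b : 'I_q, f (inl b) = b :> nat) /\
  (forall a : 'I_p, f (inr a) = n - a :> nat).
Proof.
move=> pq f_inj [lo hi] flt; split.
- case=> k; elim/ltn_ind: k => k IH kq.
  have kn : k < n.+1 by lia.
  have [[b|a] E] := line_surj pq f_inj (Ordinal kn); last first.
    have := flt (Ordinal kq) a; have := lo (Ordinal kq).
    by rewrite -E /=; lia.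
  have := lo b; rewrite -E /= leq_eqVlt => /orP[/eqP bk|bk].
    by rewrite (_ : Ordinal kq = b) ?bk -?E //; apply/val_inj.
  by have := IH _ bk (ltn_ord b); rewrite (_ : Ordinal _ = b) ?bk -?E /=; [lia|apply/val_inj].
- case=> k; elim/ltn_ind: k => k IH kp.
  have kn : n - k < n.+1 by lia.
  have [[b|a] E] := line_surj pq f_inj (Ordinal kn).
    have := flt b (Ordinal kp); have := hi (Ordinal kp).
    by rewrite -E /=; lia.
  have ak : a <= k by have := hi a; have := ltn_ord a; rewrite -E /=; lia.
  move: ak; rewrite leq_eqVlt => /orP[/eqP ak|ak].
    by rewrite (_ : Ordinal kp = a) ?ak -?E //; apply/val_inj.
  have := IH _ ak (ltn_ord a); rewrite (_ : Ordinal _ = a) ?ak -?E /=; last exact/val_inj.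
  by lia.
Qed.

Lemma reading_enumP n (c : chipconf n) :
  reading c = enum 'I_n.+1 <->
  (forall x y : 'I_n.+1, x <= y -> (c x <= c y)%R).
Proof.
set le_c := fun a b => (c a <= c b)%R.
have le_c_tr : transitive le_c by move=> y x z; exact: Order.POrderTheory.le_trans.
have le_c_refl : reflexive le_c by move=> x; exact: Order.POrderTheory.lexx.
split=> [E x y xy|mono].
  have : sorted le_c (enum 'I_n.+1).
    by rewrite -E; apply: sort_sorted => a b; exact: Order.TotalTheory.le_total.
  move/(sorted_leq_nth le_c_tr le_c_refl x)/(_ x y).
  by rewrite !inE size_enum_ord !ltn_ord !nth_ord_enum; exact.
apply: sorted_sort => //.
have : sorted leq (map val (enum 'I_n.+1)) by rewrite val_enum_ord iota_sorted.
by rewrite sorted_map; apply: sub_sorted => a b; exact: mono.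
Qed.

(** With all cells used, column [b] ends at site [b] and row [a] at site [n + 1 - a], leaving site
    [q] empty. If the reading is the identity, chips increase with [b] and decrease with [a], which
    gives the bounds by induction; the converse is [sortable_order]. *)
Lemma sortable_reading n p q (c : chipconf n)
    (f : 'I_q + 'I_p -> 'I_n.+1) l l' :
  p + q = n.+1 -> grid_state c f l l' -> stable c ->
  (reading c = enum 'I_n.+1 <-> sortable f).
Proof.
move=> pq st sc; have [lE lE'] := grid_state_stable st sc.
case: st => f_inj _ _ _ row col flt.
have {}row a : c (f (inr a)) = Posz (n.+1 - a) by rewrite row lE pq.
have {}col b : c (f (inl b)) = Posz b by rewrite col lE' addKn.
rewrite reading_enumP; split=> [mono|sf].
- have lt_c x y : (c x < c y)%R -> x < y.
    rewrite ltnNge; apply: contraL => /mono.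
    by rewrite Order.TotalTheory.leNgt => /negbTE->.
  split.
    case; elim=> [|k IH] kq //.
    apply: leq_ltn_trans (IH (ltnW kq)) _.
    by apply: lt_c; rewrite !col ltz_nat.
  case; elim=> [|k IH] kp; first by have := ltn_ord (f (inr (Ordinal kp))); rewrite /=; lia.
  have := IH (ltnW kp); rewrite /=.
  suff : f (inr (Ordinal kp)) < f (inr (Ordinal (ltnW kp))) by lia.
  by apply: lt_c; rewrite !row ltz_nat /=; lia.
- have [|fl fr] := sortable_order pq f_inj sf.
    by move=> b a; apply: flt; rewrite lE.
  move=> x y.
  have [t ->] := line_surj pq f_inj x; have [u ->] := line_surj pq f_inj y.
  case: t u => [b|a] [b'|a']; rewrite ?fl ?fr ?row ?col lez_nat.
  + by [].
  + by have := ltn_ord b; have := ltn_ord a'; lia.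
  + by have := ltn_ord b'; have := ltn_ord a; lia.
  + by have := ltn_ord a; have := ltn_ord a'; lia.
Qed.

(** * Labelings of initial configurations by grid lines *)

Definition start_site p q (t : 'I_q + 'I_p) : nat :=
  match t with inl b => p + b | inr a => p - a end.

(** Column 0 and row 0 both start at site [p], so a labeling is determined by [c0] only up to
    exchanging the two chips there. *)
Definition labels n p q (c0 : {ffun 'I_n.+1 -> 'I_n.+2})
    (f : 'I_q + 'I_p -> 'I_n.+1) : Prop :=
  injective f /\ forall t, c0 (f t) = start_site t :> nat.

Lemma labels_grid_state n p q c0 (f : 'I_q + 'I_p -> 'I_n.+1) :
  labels c0 f -> grid_state (embed c0) f (fun=> 0) (fun=> 0).
Proof.
move=> [f_inj c0f]; split=> // [a|b]; rewrite ffunE c0f /=.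
  by rewrite addn0.
by rewrite subn0.
Qed.

Lemma labels_toppleable n p q c0 (f : 'I_q + 'I_p -> 'I_n.+1) :
  p + q = n.+1 -> labels c0 f -> toppleable c0 <-> sortable f.
Proof.
move=> pq /labels_grid_state st; split=> [[cf [path [sc rc]]]|sf].
  have [f1 [l1 [l1' [st1 ->]]]] := grid_state_reachable pq st path.
  exact/(sortable_reading pq st1 sc).
have [cf [f1 [l1 [l1' [path sc st1]]]]] := grid_state_terminates pq st.
exists cf; do 2!split=> //; apply/(sortable_reading pq st1 sc).
(* Sortability is transported along the path to a labeling [f2] of [cf], then to [f1] through the
   reading of [cf], which depends on neither. *)
have [f2 [l2 [l2' [st2 /iffLR/(_ sf) sf2]]]] := grid_state_reachable pq st path.
by apply/(sortable_reading pq st1 sc)/(sortable_reading pq st2 sc).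
Qed.

Definition displacement_bounded n p q (c0 : {ffun 'I_n.+1 -> 'I_n.+2}) : bool :=
  [forall x, (c0 x <= x + p) && (x < c0 x + q)].

(** A column starts at [p + b] and a row at [p - a], so the two sortability bounds become the two
    displacement bounds. On each kind of line the other bound is automatic, chips being at most
    [n = p + q - 1]. *)
Lemma labels_sortable n p q c0 (f : 'I_q + 'I_p -> 'I_n.+1) :
  p + q = n.+1 -> labels c0 f ->
  sortable f <-> displacement_bounded p q c0.
Proof.
move=> pq [f_inj c0f]; split=> [[lo hi]|/forallP bnd].
  apply/forallP=> x; have [[b|a] ->] := line_surj pq f_inj x; rewrite c0f /=.
    by have := lo b; have := ltn_ord (f (inl b)); lia.
  by have := hi a; have := ltn_ord a; lia.
split=> [b|a].
  by have := bnd (f (inl b)); rewrite c0f /=; lia.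
by have := bnd (f (inr a)); rewrite c0f /=; have := ltn_ord a; lia.
Qed.

Lemma labels_in_S n p q c0 (f : 'I_q + 'I_p -> 'I_n.+1) :
  0 < p -> 0 < q -> p + q = n.+1 -> labels c0 f -> in_S p c0.
Proof.
move=> p0 q0 pq [f_inj c0f] s.
have site1 (t : 'I_q + 'I_p) : (forall u, start_site u = start_site t -> u = t) ->
    s = start_site t :> nat -> #|[set x | c0 x == s]| = 1.
  move=> t_uniq st; rewrite (_ : [set _ | _] = [set f t]) ?cards1 //.
  apply/setP=> x; rewrite !inE; have [u ->] := line_surj pq f_inj x.
  rewrite (inj_eq f_inj) -val_eqE /= c0f st.
  by apply/eqP/eqP=> [/t_uniq|->].
have [s0|s0] /= := eqVneq (s : nat) 0.
  apply/eqP; rewrite cards_eq0; apply/eqP/setP=> x; rewrite !inE.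
  have [[b|a] ->] := line_surj pq f_inj x; rewrite -val_eqE /= c0f /= s0.
    by lia.
  by have := ltn_ord a; lia.
have [sn|sn] /= := eqVneq (s : nat) n.+1.
  apply/eqP; rewrite cards_eq0; apply/eqP/setP=> x; rewrite !inE.
  have [[b|a] ->] := line_surj pq f_inj x; rewrite -val_eqE /= c0f /= sn.
    by have := ltn_ord b; lia.
  by lia.
have [sp|sp] := eqVneq (s : nat) p.
  rewrite (_ : [set _ | _] = [set f (inl (Ordinal q0)); f (inr (Ordinal p0))]).
    by rewrite cards2 (inj_eq f_inj).
  apply/setP=> x; rewrite !inE; have [u ->] := line_surj pq f_inj x.
  rewrite !(inj_eq f_inj) -val_eqE /= c0f sp; case: u => [b|a] /=.
    by rewrite orbF (inj_eq inl_inj) -val_eqE /=; lia.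
  by rewrite (inj_eq inr_inj) -val_eqE /=; have := ltn_ord a; lia.
have [lt_sp|lt_ps] := ltnP s p.
  have ap : p - s < p by lia.
  apply: (site1 (inr (Ordinal ap))) => /=; last by lia.
  case=> [b|a] /= E; first by lia.
  by congr inr; apply/val_inj => /=; have := ltn_ord a; lia.
have bq : s - p < q by have := ltn_ord s; lia.
apply: (site1 (inl (Ordinal bq))) => /=; last by lia.
case=> [b|a] /= E; last by lia.
by congr inl; apply/val_inj => /=; lia.
Qed.

Lemma in_S_labels n p q c0 (p0 : 0 < p) (q0 : 0 < q) :
  p + q = n.+1 -> in_S p c0 ->
  exists f : 'I_q + 'I_p -> 'I_n.+1,
    labels c0 f /\ f (inl (Ordinal q0)) < f (inr (Ordinal p0)).
Proof.
move=> pq inS.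
have pn : p < n.+2 by lia.
have [x [y [xy cx cy]]] : exists x y : 'I_n.+1, [/\ x < y, c0 x = p :> nat & c0 y = p :> nat].
  have : #|[set x | c0 x == Ordinal pn]| == 2.
    by rewrite inS /= (gtn_eqF p0) (ltn_eqF (_ : p < n.+1)) ?eqxx //; lia.
  move/cards2P => [x [y [nxy /setP E]]].
  have cx : c0 x = p :> nat by have := E x; rewrite !inE eqxx -val_eqE => /eqP.
  have cy : c0 y = p :> nat by have := E y; rewrite !inE eqxx orbT -val_eqE => /eqP.
  case: (ltngtP x y) nxy => [?|?|/val_inj->] nxy; last by rewrite eqxx in nxy.
    by exists x, y.
  by exists y, x.
(* [g] picks some chip at each starting site. Its values on column 0 and row 0 are then replaced by
   the two chips at site [p], the smaller on column 0. *)
have /fin_all_exists [g gP] (t : 'I_q + 'I_p) :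
    exists z, c0 z = start_site t :> nat.
  have site_n : start_site t < n.+2 by case: t => [b|a] /=; [have := ltn_ord b|]; lia.
  have : 0 < #|[set z | c0 z == Ordinal site_n]|.
    rewrite inS /= (_ : (_ == 0) || _ = false); first by case: ifP.
    by case: t {site_n} => [b|a] /=; [have := ltn_ord b|have := ltn_ord a]; lia.
  by case/card_gt0P=> z; rewrite inE -val_eqE => /eqP; exists z.
pose f t := if t == inl (Ordinal q0) then x else
            if t == inr (Ordinal p0) then y else g t.
exists f; split; last by rewrite /f !eqxx.
have c0f t : c0 (f t) = start_site t :> nat.
  rewrite /f; case: eqP => [->|_]; first by rewrite cx /= addn0.
  by case: eqP => [->|_] //; rewrite cy /= subn0.
split=> // t u ftu; have := c0f t; rewrite ftu c0f.
have f0 : f (inl (Ordinal q0)) <> f (inr (Ordinal p0)).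
  by rewrite /f !eqxx => E; rewrite E ltnn in xy.
have b0 (b : 'I_q) : b = 0 :> nat -> b = Ordinal q0 by move=> ?; apply/val_inj.
have a0 (a : 'I_p) : a = 0 :> nat -> a = Ordinal p0 by move=> ?; apply/val_inj.
case: t u ftu => [b|a] [b'|a'] ftu /= E.
- by congr inl; apply/val_inj => /=; lia.
- have bE : b = 0 :> nat by lia.
  have aE : a' = 0 :> nat by have := ltn_ord a'; lia.
  by case: f0; rewrite -(b0 _ bE) -(a0 _ aE).
- have bE : b' = 0 :> nat by lia.
  have aE : a = 0 :> nat by have := ltn_ord a; lia.
  by case: f0; rewrite -(b0 _ bE) -(a0 _ aE).
- by congr inr; apply/val_inj => /=; have := ltn_ord a; have := ltn_ord a'; lia.
Qed.

(** * Rook placements on staircases *)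

(** For a rook placement, [undef a] is the set of empty rows and [avoided a] the set of empty
    columns. *)
Definition undef (X : finType) (a : {ffun X -> option X}) := [set x | a x == None].
Definition avoided (X : finType) (a : {ffun X -> option X}) :=
  [set y | [forall x, a x != Some y]].

(* Nonattacking rook placements on the board r, i.e. partial injections whose
   graph lies in r. *)
Definition rooks (X : finType) (r : rel X) : {set {ffun X -> option X}} :=
  [set a : {ffun X -> option X} |
    [forall x, if a x is Some y then r x y else true] &&
    [forall x, forall y, (a x == a y) ==> (a x != None) ==> (x == y)]].

Lemma rooksP (X : finType) (r : rel X) (a : {ffun X -> option X}) :
  reflect ((forall x y, a x = Some y -> r x y) /\
           (forall x y z, a x = Some z -> a y = Some z -> x = y))
    (a \in rooks r).
Proof.
rewrite inE; apply: (iffP andP) => -[ar a_inj]; split.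
- by move=> x y axy; have := forallP ar x; rewrite axy.
- move=> x y z ax ay; have /forallP/(_ y) := forallP a_inj x.
  by rewrite ax ay eqxx => /eqP.
- by apply/forallP=> x; case E: (a x) => // ; exact: ar.
- apply/forallP=> x; apply/forallP=> y; apply/implyP=> /eqP E; apply/implyP.
  by case Ex: (a x) => [z|//] _; apply/eqP/(a_inj _ _ z); rewrite -?E.
Qed.

(** Occupied rows and occupied columns are both in bijection with the rooks. *)
Lemma card_avoided (X : finType) (r : rel X) a :
  a \in rooks r -> #|avoided a| = #|undef a|.
Proof.
case/rooksP=> _ a_inj.
have : #|~: avoided a| = #|~: undef a|.
  rewrite -(card_imset (~: avoided a) (@Some_inj _ : injective (@Some X))).
  rewrite -(card_in_imset (f := a)); last first.
    move=> x y; rewrite !inE; case E: (a x) => [z|//] _ _ E'.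
    by apply: (a_inj x y z).
  apply: eq_card => o; apply/imsetP/imsetP=> -[].
    move=> y; rewrite !inE => /forallPn[x]; rewrite negbK => /eqP E ->.
    by exists x; rewrite ?inE E.
  move=> x; rewrite !inE; case E: (a x) => [y|//] _ ->; exists y => //.
  by rewrite !inE; apply/forallPn; exists x; rewrite E eqxx.
by have := cardsC (avoided a); have := cardsC (undef a); lia.
Qed.

(** The index [m] counts the empty rows, so the placements have [#|X| - m] rooks. *)
Definition rook_number (X : finType) (r : rel X) m :=
  #|[set a in rooks r | #|undef a| == m]|.

Section Staircase.
Variable q : nat.
Notation le_ord k := (fun i j : 'I_k => i <= j).

(** A row 0 and a column 0 are added in front of the old board. On the staircase [i <= j], row 0
    meets every column while column 0 meets only row 0. *)
Definition add_row (z : option 'I_q.+1) (a : {ffun 'I_q -> option 'I_q}) :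
    {ffun 'I_q.+1 -> option 'I_q.+1} :=
  [ffun i => if unlift ord0 i is Some j then omap (lift ord0) (a j) else z].

Lemma add_row0 z a : add_row z a ord0 = z.
Proof. by rewrite ffunE unlift_none. Qed.

Lemma add_rowS z a j : add_row z a (lift ord0 j) = omap (lift ord0) (a j).
Proof. by rewrite ffunE liftK. Qed.

Lemma omap_lift_inj : injective (omap (@lift q.+1 ord0)).
Proof. by apply: inj_omap; exact: lift_inj. Qed.

Lemma add_row_inj : injective (fun u => add_row u.1 u.2).
Proof.
move=> [z a] [z' a'] /= /ffunP E; congr pair.
  by have := E ord0; rewrite !add_row0.
by apply/ffunP=> j; apply/omap_lift_inj; have := E (lift ord0 j); rewrite !add_rowS.
Qed.

Lemma add_row_rooks z a :
  (add_row z a \in rooks (le_ord q.+1)) =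
  (a \in rooks (le_ord q)) && (if z is Some y then y \in avoided (add_row None a) else true).
Proof.
apply/rooksP/andP=> [[le_b b_inj]|[/rooksP[le_a a_inj] zP]].
  split.
    apply/rooksP; split=> [x y axy|x y w ax ay].
      by have := le_b (lift ord0 x) (lift ord0 y); rewrite add_rowS axy; exact.
    have := b_inj (lift ord0 x) (lift ord0 y) (lift ord0 w).
    by rewrite !add_rowS ax ay => /(_ erefl erefl)/lift_inj.
  case: z le_b b_inj => // y le_b b_inj; rewrite inE; apply/forallP=> x.
  case: (unliftP ord0 x) => [j ->|->]; last by rewrite add_row0.
  rewrite add_rowS; apply/eqP=> E.
  by have := b_inj ord0 (lift ord0 j) y; rewrite add_row0 add_rowS E => /(_ erefl erefl).
have zN x y : z = Some y -> add_row z a (lift ord0 x) <> Some y.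
  move=> zE; move: zP; rewrite zE inE => /forallP/(_ (lift ord0 x)).
  by rewrite !add_rowS => /eqP.
split=> [x y|x y w].
  case: (unliftP ord0 x) => [j ->|->] //; rewrite add_rowS.
  by case E: (a j) => [k|//] /= [<-]; rewrite /= !/bump /= ltnS; exact: le_a.
case: (unliftP ord0 x) => [j ->|->]; case: (unliftP ord0 y) => [k ->|->] //.
- rewrite !add_rowS; case Ej: (a j) => [u|//] /= [<-].
  case Ek: (a k) => [v|//] /= /Some_inj/lift_inj uv.
  by congr lift; apply: (a_inj _ _ u); rewrite // -uv.
- by rewrite add_row0 => E /(zN j w) [].
- by rewrite add_row0 => /zN h /h.
Qed.

Lemma undef_add_row z a : #|undef (add_row z a)| = (z == None) + #|undef a|.
Proof.
rewrite -!sum1_card big_mkcond /= big_ord_recl inE add_row0; congr (_ + _).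
by rewrite [RHS]big_mkcond; apply: eq_bigr => j _; rewrite !inE add_rowS; case: (a j).
Qed.

(** A rook in a later row cannot stand in column 0, so deleting row 0 and column 0 leaves a
    placement on the smaller board. *)
Lemma rooks_recl :
  rooks (le_ord q.+1) =
  [set add_row u.1 u.2 | u in
    [set u : option 'I_q.+1 * {ffun 'I_q -> option 'I_q} |
      add_row u.1 u.2 \in rooks (le_ord q.+1)]].
Proof.
apply/setP=> a; apply/idP/imsetP=> [aP|[u]]; last by rewrite inE => uP ->.
have [le_a _] := rooksP _ _ aP.
have /fin_all_exists [b bP] (j : 'I_q) : exists o, a (lift ord0 j) = omap (lift ord0) o.
  case E: (a (lift ord0 j)) => [y|]; last by exists None.
  case: (unliftP ord0 y) E => [k ->|->] E; first by exists (Some k).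
  by have := le_a _ _ E.
suff E : a = add_row (a ord0) (finfun b) by exists (a ord0, finfun b); rewrite 1?inE /= -?E.
apply/ffunP=> i; case: (unliftP ord0 i) => [j ->|->]; rewrite ?add_row0 //.
by rewrite add_rowS bP ffunE.
Qed.

(** Either row 0 receives a rook in one of the [m + 1] empty columns, keeping [m] empty rows, or it
    stays empty and raises their number from [m - 1] to [m]. This is the Stirling recurrence for
    [S(q+2, m+1)]. *)
Lemma rook_number_recl m :
  rook_number (le_ord q.+1) m =
  m.+1 * rook_number (le_ord q) m +
  (if m is m'.+1 then rook_number (le_ord q) m' else 0).
Proof.
pose P u := add_row u.1 u.2 \in rooks (le_ord q.+1).
pose M u := #|undef (add_row u.1 u.2)| == m.
have -> : rook_number (le_ord q.+1) m = #|[set u | P u && M u]|.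
  rewrite -(card_imset _ add_row_inj); apply: eq_card => a.
  apply/idP/imsetP => [|[u]]; last by rewrite inE => uP ->; rewrite inE.
  rewrite inE [in X in X -> _]rooks_recl => /andP[/imsetP[u]].
  by rewrite inE => uP -> Mu; exists u; rewrite // inE; apply/andP.
rewrite -sum1_card.
under eq_bigl => u do rewrite inE.
rewrite big_mkcond /= -(pair_bigA _ (fun z a => if P (z, a) && M (z, a) then 1 else 0)) /=.
rewrite exchange_big /=.
transitivity (\sum_(a in rooks (le_ord q))
   ((if #|undef a| == m then m.+1 else 0) + (#|undef a|.+1 == m))).
  rewrite [RHS]big_mkcond; apply: eq_bigr => a _.
  case: ifP => aP; last by rewrite big1 // => z _; rewrite /P /= add_row_rooks aP.
  rewrite (bigID (fun z => z == None)) /= addnC big_pred1_eq; congr (_ + _); last first.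
    by rewrite /P /M /= add_row_rooks aP undef_add_row; case: eqP.
  rewrite (reindex_omap Some id) /=; last by case.
  under eq_bigl => y do rewrite eqxx.
  (* Leaving row 0 empty adds one empty row, hence by [card_avoided] one empty column; these columns
     are the possible places of the new rook. *)
  have card_y : #|avoided (add_row None a)| = #|undef a|.+1.
    by rewrite (@card_avoided _ (le_ord q.+1)) ?undef_add_row // add_row_rooks aP.
  under eq_bigr => y _ do rewrite /P /M /= add_row_rooks aP undef_add_row /= add0n.
  rewrite -big_mkcond /=; case: eqP => [<-|_];
    last by rewrite big_pred0 // => y; rewrite andbF.
  by under eq_bigl => y do rewrite andbT; rewrite sum1_card.
rewrite big_split /= /rook_number; congr (_ + _).
  rewrite -big_mkcondr /= sum_nat_const mulnC; congr (_ * _).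
  by apply: eq_card => a; rewrite [RHS]inE.
case: m {P M} => [|m]; first by rewrite big1.
rewrite -sum1_card [RHS]big_mkcond [LHS]big_mkcond; apply: eq_bigr => a _.
by rewrite [in RHS]inE eqSS; case: (a \in _) => //=; case: eqP.
Qed.

End Staircase.

Lemma rook_number_staircase q m :
  rook_number (fun i j : 'I_q => i <= j) m = stirling2 q.+1 m.+1.
Proof.
elim: q m => [|q IH] m; last first.
  rewrite rook_number_recl IH [in RHS]/=; congr (_ + _).
  by case: m => // m; rewrite IH.
rewrite /rook_number.
case: m => [|m] /=.
  rewrite (_ : [set _ in _ | _] = setT) ?cardsT ?card_ffun ?card_ord ?expn0 //.
  apply/setP=> a; rewrite !inE; apply/andP; split.
    by apply/andP; split; apply/forallP => -[].
  by rewrite cards_eq0; apply/eqP/setP=> -[].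
rewrite (_ : [set _ in _ | _] = set0) ?cards0 // ?muln0 //.
apply/setP=> a; rewrite !inE; apply/negbTE; rewrite negb_and; apply/orP; right.
by rewrite (_ : undef a = set0) ?cards0 //; apply/setP=> -[].
Qed.

(** * Permutations with two staircase blocks *)

Section Blocks.
Variables X Y : finType.

Definition left_block (g : {ffun X + Y -> X + Y}) : {ffun X -> option X} :=
  [ffun x => if g (inl x) is inl x' then Some x' else None].

Definition right_block (g : {ffun X + Y -> X + Y}) : {ffun Y -> option Y} :=
  [ffun y => if g (inr y) is inr y' then Some y' else None].

(** Once the diagonal blocks are fixed, [g] amounts to two independent injections: the empty rows of
    [a] into the empty columns of [b], and the empty rows of [b] into those of [a]. *)
Lemma card_fixed_blocks (rX : rel X) (rY : rel Y) a b :
  a \in rooks rX -> b \in rooks rY ->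
  #|[set g : {ffun X + Y -> X + Y} |
      [&& injectiveb g, left_block g == a & right_block g == b]]| =
  #|avoided b| ^_ #|undef a| * #|avoided a| ^_ #|undef b|.
Proof.
move=> /rooksP[_ a_inj] /rooksP[_ b_inj].
pose DX := {x | x \in undef a}; pose DY := {y | y \in undef b}.
pose H := [set h : {ffun DX -> Y} in ffun_on (mem (avoided b)) | injectiveb h].
pose K := [set k : {ffun DY -> X} in ffun_on (mem (avoided a)) | injectiveb k].
(* The final [t] in each branch is only a filler: [a x = None] puts [x] in [undef a], so [insub x]
   succeeds, and likewise for [b]. *)
pose glue (hk : {ffun DX -> Y} * {ffun DY -> X}) : {ffun X + Y -> X + Y} :=
  [ffun t => match t with
   | inl x => if a x is Some x' then inl x' else
              if insub x is Some u then inr (hk.1 u) else t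
   | inr y => if b y is Some y' then inr y' else
              if insub y is Some v then inl (hk.2 v) else t
   end].
have inX x : a x = None -> exists u : DX, x = val u.
  by move=> ax; have ux : x \in undef a; [rewrite inE ax | exists (Sub x ux)].
have inY y : b y = None -> exists v : DY, y = val v.
  by move=> bY; have uy : y \in undef b; [rewrite inE bY | exists (Sub y uy)].
have uN (u : DX) : a (val u) = None by have := valP u; rewrite inE => /eqP.
have vN (v : DY) : b (val v) = None by have := valP v; rewrite inE => /eqP.
have glue_a hk x x' : a x = Some x' -> glue hk (inl x) = inl x'.
  by move=> ax; rewrite ffunE ax.
have glue_b hk y y' : b y = Some y' -> glue hk (inr y) = inr y'.
  by move=> bY; rewrite ffunE bY.
have glue_h hk u : glue hk (inl (val u)) = inr (hk.1 u) by rewrite ffunE uN valK.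
have glue_k hk v : glue hk (inr (val v)) = inl (hk.2 v) by rewrite ffunE vN valK.
have glue_inj : injective glue.
  move=> [h k] [h' k'] /ffunP E; congr pair; apply/ffunP=> u.
    by have := E (inl (val u)); rewrite !glue_h => -[].
  by have := E (inr (val u)); rewrite !glue_k => -[].
have -> : [set g : {ffun X + Y -> X + Y} |
            [&& injectiveb g, left_block g == a & right_block g == b]] =
          glue @: setX H K.
  apply/setP=> g; rewrite inE; apply/and3P/imsetP.
    case=> /injectiveP g_inj /eqP/ffunP ga /eqP/ffunP gb.
    have /fin_all_exists[h hP] (u : DX) : exists y, g (inl (val u)) = inr y.
      by have := ga (val u); rewrite ffunE uN; case: (g _) => // y _; exists y.
    have /fin_all_exists[k kP] (v : DY) : exists x, g (inr (val v)) = inl x.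
      by have := gb (val v); rewrite ffunE vN; case: (g _) => // x _; exists x.
    have g_a x x' : a x = Some x' -> g (inl x) = inl x'.
      by have := ga x; rewrite ffunE => <-; case: (g _) => // z [->].
    have g_b y y' : b y = Some y' -> g (inr y) = inr y'.
      by have := gb y; rewrite ffunE => <-; case: (g _) => // z [->].
    exists (finfun h, finfun k).
      rewrite !inE /=; apply/andP; split; apply/andP; split.
      - apply/ffun_onP=> u; rewrite ffunE inE; apply/forallP=> y; apply/eqP=> /g_b.
        by rewrite -hP => /g_inj.
      - apply/injectiveP=> u u'; rewrite !ffunE => E.
        by have := hP u; rewrite E -hP => /g_inj[]/val_inj.
      - apply/ffun_onP=> v; rewrite ffunE inE; apply/forallP=> x; apply/eqP=> /g_a.
        by rewrite -kP => /g_inj.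
      - apply/injectiveP=> v v'; rewrite !ffunE => E.
        by have := kP v; rewrite E -kP => /g_inj[]/val_inj.
    apply/ffunP=> -[x|y].
      case ax: (a x) => [x'|]; first by rewrite (g_a x x') ?(glue_a _ x x').
      by have [u ->] := inX x ax; rewrite glue_h hP ffunE.
    case bY: (b y) => [y'|]; first by rewrite (g_b y y') ?(glue_b _ y y').
    by have [u ->] := inY y bY; rewrite glue_k kP ffunE.
  case=> -[h k]; rewrite inE => /andP[]; rewrite !inE.
  move=> /andP[/ffun_onP hr /injectiveP h_inj] /andP[/ffun_onP kr /injectiveP k_inj] ->.
  have {}hr u y : b y <> Some (h u).
    by have := hr u; rewrite inE => /forallP/(_ y)/eqP.
  have {}kr v x : a x <> Some (k v).
    by have := kr v; rewrite inE => /forallP/(_ x)/eqP.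
  split.
  - apply/injectiveP=> -[x|y] -[x'|y'].
    + case ax: (a x) => [z|]; case ax': (a x') => [z'|].
      * rewrite (glue_a _ x z) // (glue_a _ x' z') // => -[E].
        by congr inl; apply: (a_inj _ _ z); rewrite ?ax' -?E.
      * by have [u ->] := inX x' ax'; rewrite (glue_a _ x z) // glue_h.
      * by have [u ->] := inX x ax; rewrite (glue_a _ x' z') // glue_h.
      * have [u ->] := inX x ax; have [u' ->] := inX x' ax'.
        by rewrite !glue_h => -[/h_inj->].
    + case ax: (a x) => [z|]; case bY: (b y') => [z'|].
      * by rewrite (glue_a _ x z) // (glue_b _ y' z').
      * have [u ->] := inY y' bY; rewrite (glue_a _ x z) // glue_k => -[E].
        by case: (kr u x); rewrite ax E.
      * have [u ->] := inX x ax; rewrite (glue_b _ y' z') // glue_h => -[E].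
        by case: (hr u y'); rewrite bY -E.
      * by have [u ->] := inX x ax; have [v ->] := inY y' bY; rewrite glue_h glue_k.
    + case ax: (a x') => [z|]; case bY: (b y) => [z'|].
      * by rewrite (glue_a _ x' z) // (glue_b _ y z').
      * have [u ->] := inY y bY; rewrite (glue_a _ x' z) // glue_k => -[E].
        by case: (kr u x'); rewrite ax -E.
      * have [u ->] := inX x' ax; rewrite (glue_b _ y z') // glue_h => -[E].
        by case: (hr u y); rewrite bY E.
      * by have [u ->] := inX x' ax; have [v ->] := inY y bY; rewrite glue_h glue_k.
    + case bY: (b y) => [z|]; case bY': (b y') => [z'|].
      * rewrite (glue_b _ y z) // (glue_b _ y' z') // => -[E].
        by congr inr; apply: (b_inj _ _ z); rewrite ?bY' -?E.
      * by have [u ->] := inY y' bY'; rewrite (glue_b _ y z) // glue_k.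
      * by have [u ->] := inY y bY; rewrite (glue_b _ y' z') // glue_k.
      * have [u ->] := inY y bY; have [u' ->] := inY y' bY'.
        by rewrite !glue_k => -[/k_inj->].
  - apply/eqP/ffunP=> x; rewrite ffunE.
    case ax: (a x) => [x'|]; first by rewrite (glue_a _ _ x').
    by have [u ->] := inX x ax; rewrite glue_h.
  - apply/eqP/ffunP=> y; rewrite ffunE.
    case bY: (b y) => [y'|]; first by rewrite (glue_b _ _ y').
    by have [u ->] := inY y bY; rewrite glue_k.
by rewrite card_imset // cardsX !card_inj_ffuns_on !card_sig.
Qed.

Lemma card_block_rooks (rX : rel X) (rY : rel Y) :
  #|[set g : {ffun X + Y -> X + Y} |
     [&& injectiveb g, left_block g \in rooks rX & right_block g \in rooks rY]]| =
  \sum_(0 <= m < #|X|.+1) m`! ^ 2 * rook_number rX m * rook_number rY m.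
Proof.
transitivity (\sum_(a in rooks rX) #|undef a|`! ^ 2 * rook_number rY #|undef a|).
  rewrite -sum1_card.
  under eq_bigl => g do rewrite inE.
  rewrite (partition_big left_block (mem (rooks rX))) /=; last by move=> g /and3P[].
  apply: eq_bigr => a aP.
  rewrite (partition_big right_block (mem (rooks rY))) /=; last first.
    by move=> g /andP[/and3P[]].
  rewrite /rook_number mulnC -sum_nat_const (big_mkcond (mem (rooks rY))).
  rewrite [RHS]big_mkcond /=; apply: eq_bigr => b _; rewrite [in RHS]inE.
  case bP: (b \in rooks rY) => //=.
  have := card_fixed_blocks aP bP; rewrite (card_avoided aP) (card_avoided bP) => E.
  transitivity (#|undef b| ^_ #|undef a| * #|undef a| ^_ #|undef b|).
    rewrite -E -sum1_card; apply: eq_bigl => g; rewrite inE.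
    case: eqP => [->|]; last by rewrite !andbF.
    by case: eqP => [->|]; rewrite ?aP ?bP ?andbF ?andbT.
  (* The product of falling factorials vanishes unless both blocks have the same number [m] of empty
     rows, and then equals the square of [m!]. *)
  case: ltngtP => [?|?|->]; last by rewrite ffactnn -mulnn.
    by rewrite ffact_small.
  by rewrite mulnC ffact_small.
rewrite big_mkord (partition_big (fun a => inord #|undef a| : 'I_#|X|.+1) predT) //=.
apply: eq_bigr => m _; rewrite mulnAC.
have le_a (a : {ffun X -> option X}) : #|undef a| < #|X|.+1 by rewrite ltnS max_card.
rewrite [RHS]mulnC /rook_number -sum_nat_const.
apply: eq_big => [a|a /andP[_ /eqP <-]]; last by rewrite inordK.
by rewrite [in RHS]inE -val_eqE /= inordK.
Qed.

End Blocks.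

Lemma stirling2_gt n k : n < k -> stirling2 n k = 0.
Proof.
elim: n k => [|n IH] [|k] //= nk.
by rewrite !IH ?muln0 // ltnW.
Qed.

Local Arguments stirling2 : simpl never.

Lemma card_staircase_blocks q p :
  #|[set g : {ffun 'I_q + 'I_p -> 'I_q + 'I_p} |
      [&& injectiveb g,
          left_block g \in rooks (fun i j : 'I_q => i <= j) &
          right_block g \in rooks (fun i j : 'I_p => i <= j)]]| = polyBernB q p.
Proof.
rewrite card_block_rooks card_ord /polyBernB.
under eq_bigr => m _ do rewrite !rook_number_staircase.
(* Terms with [minn q p < m <= q] have [m > p], so [S(p+1, m+1) = 0]. *)
rewrite (@big_cat_nat _ _ _ (minn q p).+1) //=; last by rewrite ltnS geq_minl.
rewrite [X in _ + X]big_nat_cond [X in _ + X]big1 ?addn0 // => m.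
by rewrite andbT => /andP[mn mq]; rewrite (@stirling2_gt p.+1) ?muln0 //; lia.
Qed.

(** * Counting labelings *)

Definition sortableb n p q (f : {ffun 'I_q + 'I_p -> 'I_n.+1}) : bool :=
  [forall b : 'I_q, b <= f (inl b)] && [forall a : 'I_p, f (inr a) + a <= n].

Lemma sortableP n p q (f : {ffun 'I_q + 'I_p -> 'I_n.+1}) :
  reflect (sortable f) (sortableb f).
Proof. by apply: (iffP andP) => -[/forallP ? /forallP ?]. Qed.

(** Chip [b] is renamed column [b] and chip [n - a] row [a]. On the diagonal blocks the bounds
    become the staircase conditions [b <= b'] and [a <= a']; on the other blocks they hold
    automatically, because [p + q = n + 1]. *)
Lemma card_sortable n p q :
  p + q = n.+1 ->
  #|[set f : {ffun 'I_q + 'I_p -> 'I_n.+1} | injectiveb f && sortableb f]| =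
  polyBernB q p.
Proof.
move=> pq; rewrite -card_staircase_blocks.
have chip_lt (t : 'I_q + 'I_p) :
    (match t with inl b => b : nat | inr a => n - a end) < n.+1.
  by case: t => [b|a]; [have := ltn_ord b|]; lia.
pose chip (t : 'I_q + 'I_p) : 'I_n.+1 := Ordinal (chip_lt t).
have chip_inj : injective chip.
  move=> [b|a] [b'|a'] /(congr1 val) /= E.
  - by congr inl; apply/val_inj.
  - by have := ltn_ord b; have := ltn_ord a'; lia.
  - by have := ltn_ord b'; have := ltn_ord a; lia.
  - by congr inr; apply/val_inj => /=; have := ltn_ord a; have := ltn_ord a'; lia.
have [line chipK lineK] : bijective chip.
  by apply: inj_card_bij; rewrite // card_sum !card_ord addnC pq.
pose lab (g : {ffun 'I_q + 'I_p -> 'I_q + 'I_p}) : {ffun 'I_q + 'I_p -> 'I_n.+1} :=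
  [ffun t => chip (g t)].
have lab_inj : injective lab.
  by move=> g g' /ffunP E; apply/ffunP=> t; apply: chip_inj; have := E t; rewrite !ffunE.
rewrite -(card_imset _ lab_inj); apply: eq_card => f; apply/idP/imsetP.
  rewrite inE => /andP[/injectiveP f_inj /sortableP[lo hi]].
  have [g gE] : exists g : {ffun 'I_q + 'I_p -> 'I_q + 'I_p}, forall t, f t = chip (g t).
    by exists [ffun t => line (f t)] => t; rewrite ffunE lineK.
  have g_inj : injective g.
    by move=> t u E; apply: f_inj; rewrite !gE E.
  exists g; last by apply/ffunP=> t; rewrite ffunE -gE.
  rewrite inE; apply/and3P; split; first exact/injectiveP.
    apply/rooksP; split=> [x y|x y z]; rewrite !ffunE.
      by have := lo x; rewrite gE; case: (g _) => // b /= ? [<-].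
    case Ex: (g (inl x)) => [x'|//] [<-]; case Ey: (g (inl y)) => [y'|//] [E].
    by have : g (inl x) = g (inl y); [rewrite Ex Ey E|move/g_inj=> []].
  apply/rooksP; split=> [x y|x y z]; rewrite !ffunE.
    have := hi x; have := ltn_ord x; rewrite gE; case: (g _) => // b /= ? ? [<-].
    by have := ltn_ord b; lia.
  case Ex: (g (inr x)) => [//|x'] [<-]; case Ey: (g (inr y)) => [//|y'] [E].
  by have : g (inr x) = g (inr y); [rewrite Ex Ey E|move/g_inj=> []].
case=> g; rewrite inE => /and3P[/injectiveP g_inj /rooksP[lo _] /rooksP[hi _]] ->.
rewrite inE; apply/andP; split.
  by apply/injectiveP=> t u; rewrite !ffunE => /chip_inj/g_inj.
apply/sortableP; split=> [b|a]; rewrite ffunE.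
  have := lo b; rewrite ffunE; case: (g _) => [b'|a'] /=; first by move=> /(_ _ erefl).
  by have := ltn_ord b; have := ltn_ord a'; lia.
have := hi a; rewrite ffunE; case: (g _) => [b'|a'] /=.
  by have := ltn_ord b'; have := ltn_ord a; lia.
by move=> /(_ _ erefl); have := ltn_ord a'; lia.
Qed.

(** The bounds on column 0 and row 0 hold for every chip. Exchanging the chips on these lines is
    thus an involution of the sortable labelings, and it reverses the order of the two chips. *)
Lemma card_sortable_ltn n p q (p0 : 0 < p) (q0 : 0 < q) :
  p + q = n.+1 ->
  2 * #|[set f : {ffun 'I_q + 'I_p -> 'I_n.+1} |
          [&& injectiveb f, sortableb f & f (inl (Ordinal q0)) < f (inr (Ordinal p0))]]| =
  polyBernB q p.
Proof.
move=> pq; rewrite -(card_sortable pq).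
set t0 := inl (Ordinal q0); set t1 := inr (Ordinal p0).
set F' := [set f | [&& _, _ & _]]; set F := [set f | _ && _].
pose sw (t : 'I_q + 'I_p) := if t == t0 then t1 else if t == t1 then t0 else t.
have swK : involutive sw.
  move=> t; rewrite /sw; have [->|n0] := eqVneq t t0; first by rewrite eqxx.
  have [->|n1] := eqVneq t t1; first by rewrite eqxx.
  by rewrite (negPf n0) (negPf n1).
pose flip (f : {ffun 'I_q + 'I_p -> 'I_n.+1}) : {ffun 'I_q + 'I_p -> 'I_n.+1} :=
  [ffun t => f (sw t)].
have flipK : involutive flip by move=> f; apply/ffunP=> t; rewrite !ffunE swK.
have flip0 f : flip f t0 = f t1 by rewrite ffunE /sw eqxx.
have flip1 f : flip f t1 = f t0 by rewrite ffunE /sw.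
have flip_F f : (flip f \in F) = (f \in F).
  suff H g : g \in F -> flip g \in F.
    by apply/idP/idP => /H; rewrite ?flipK.
  rewrite !inE => /andP[/injectiveP g_inj /sortableP[lo hi]]; apply/andP; split.
    by apply/injectiveP=> t u; rewrite !ffunE => /g_inj/(can_inj swK).
  apply/sortableP; split=> [b|a]; rewrite ffunE /sw.
    case: eqP => [[->]|_] //; exact: lo.
  have [->|na] := eqVneq a (Ordinal p0); first by rewrite /= ?eqxx ?addn0 -ltnS.
  by rewrite ifN.
have F'E : F' = F :&: [set f : {ffun 'I_q + 'I_p -> 'I_n.+1} | f t0 < f t1].
  by apply/setP=> f; rewrite !inE andbA.
rewrite -(cardsID [set f : {ffun 'I_q + 'I_p -> 'I_n.+1} | f t0 < f t1] F) -F'E.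
rewrite mul2n -addnn; congr (_ + _).
rewrite -(card_imset _ (can_inj flipK)); apply: eq_card => f; apply/imsetP/idP.
  case=> g; rewrite F'E inE => /andP[gF]; rewrite inE => lt_g ->.
  by rewrite inE flip_F gF andbT inE flip0 flip1 -leqNgt ltnW.
rewrite inE => /andP[]; rewrite inE -leqNgt => le_f fF; exists (flip f); rewrite ?flipK //.
rewrite F'E inE flip_F fF inE flip0 flip1 ltn_neqAle le_f andbT.
move: fF; rewrite inE => /andP[/injectiveP f_inj _].
by rewrite (inj_eq val_inj) (inj_eq f_inj).
Qed.

(** Column 0 and row 0 are the only distinct lines with a common starting site, and the order
    condition decides which of the two chips goes on which. *)
Lemma labels_uniq n p q c0 (p0 : 0 < p) (q0 : 0 < q)
    (f g : {ffun 'I_q + 'I_p -> 'I_n.+1}) :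
  p + q = n.+1 -> labels c0 f -> labels c0 g ->
  f (inl (Ordinal q0)) < f (inr (Ordinal p0)) ->
  g (inl (Ordinal q0)) < g (inr (Ordinal p0)) -> f = g.
Proof.
set t0 := inl _; set t1 := inr _ => pq [f_inj cf] [g_inj cg] lt_f lt_g.
have site_eq (t u : 'I_q + 'I_p) : start_site t = start_site u ->
    [\/ t = u, t = t0 /\ u = t1 | t = t1 /\ u = t0].
  case: t u => [b|a] [b'|a'] /= E.
  - by constructor 1; congr inl; apply/val_inj => /=; lia.
  - by constructor 2; split; [congr inl|congr inr]; apply/val_inj => /=;
      have := ltn_ord a'; lia.
  - by constructor 3; split; [congr inr|congr inl]; apply/val_inj => /=;
      have := ltn_ord a; lia.
  - constructor 1; congr inr; apply/val_inj => /=.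
    by have := ltn_ord a; have := ltn_ord a'; lia.
have f_g t : t != t0 -> t != t1 -> f t = g t.
  move=> /eqP n0 /eqP n1; have [u E] := line_surj pq g_inj (f t).
  by have := cf t; rewrite E cg => /site_eq[->|[_ ?]|[_ ?]].
have f01 t : t = t0 \/ t = t1 -> f t = g t0 \/ f t = g t1.
  move=> tE; have [u E] := line_surj pq g_inj (f t).
  have := cf t; rewrite E cg => /site_eq[->|[-> _]|[-> _]]; [|by left|by right].
  by case: tE => ->; [left|right].
apply/ffunP=> t; have [->|n0] := eqVneq t t0;
  last (have [->|n1] := eqVneq t t1; last exact: f_g).
  case: (f01 t0) => [|//|E0]; first by left.
  case: (f01 t1) => [|E1|E1]; first by right.
    by move: lt_f lt_g; rewrite E0 E1; lia.
  by move: lt_f; rewrite E0 E1 ltnn.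
case: (f01 t1) => [|E1|//]; first by right.
case: (f01 t0) => [|E0|E0]; first by left.
  by move: lt_f; rewrite E0 E1 ltnn.
by move: lt_f lt_g; rewrite E0 E1; lia.
Qed.

Theorem theorem2p4 (n p : nat) :
  (1 <= n)%N -> (1 <= p <= n)%N ->
  exists A : {set {ffun 'I_n.+1 -> 'I_n.+2}},
    (forall c0, c0 \in A <-> (in_S p c0 /\ toppleable c0)) /\
    (2 * #|A|)%N = polyBernB (n - p + 1) p.
Proof.
move=> _ /andP[p0 pn]; set q := n - p + 1.
have q0 : 0 < q by rewrite /q; lia.
have pq : p + q = n.+1 by rewrite /q; lia.
pose F := [set f : {ffun 'I_q + 'I_p -> 'I_n.+1} |
  [&& injectiveb f, sortableb f & f (inl (Ordinal q0)) < f (inr (Ordinal p0))]].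
(* Each chip is placed at the start of its line. The default 0 is never taken for injective [f],
   which is onto by cardinality. *)
pose conf (f : {ffun 'I_q + 'I_p -> 'I_n.+1}) : {ffun 'I_n.+1 -> 'I_n.+2} :=
  [ffun x => inord (if [pick t | f t == x] is Some t then start_site t else 0)].
have site_lt (t : 'I_q + 'I_p) : start_site t < n.+2.
  by case: t => [b|a] /=; [have := ltn_ord b|]; lia.
have confP (f : {ffun 'I_q + 'I_p -> 'I_n.+1}) : injective f -> labels (conf f) f.
  move=> f_inj; split=> // t; rewrite ffunE; case: pickP => [u /eqP/f_inj->|/(_ t)].
    by rewrite inordK.
  by rewrite eqxx.
have toppleP (f : {ffun 'I_q + 'I_p -> 'I_n.+1}) c0 : labels c0 f -> in_S p c0 /\
    (toppleable c0 <-> sortableb f).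
  move=> lab; split; first exact: labels_in_S p0 q0 pq lab.
  by rewrite (labels_toppleable pq lab); split=> /sortableP.
(* Requiring the smaller chip of site [p] on column 0 selects one labeling per configuration, so
   [conf] is injective on [F]. *)
exists (conf @: F); split=> [c0|]; last first.
  rewrite card_in_imset ?card_sortable_ltn // => f g.
  rewrite !inE => /and3P[/injectiveP f_inj _ lt_f] /and3P[/injectiveP g_inj _ lt_g] E.
  have labf := confP f f_inj; have := confP g g_inj; rewrite -E => labg.
  exact: labels_uniq labf labg lt_f lt_g.
split.
  case/imsetP=> f; rewrite inE => /and3P[/injectiveP f_inj sf _] ->.
  by have [inS /iffRL/(_ sf)] := toppleP f _ (confP f f_inj).
case=> inS top; have [f [[f_inj c0f] lt_f]] := in_S_labels p0 q0 pq inS.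
have lab : labels c0 (finfun f).
  by split=> [t u|t]; rewrite !ffunE // => /f_inj.
have [_ /iffLR/(_ top) sf] := toppleP _ _ lab.
have inj_f : injective (finfun f) by case: lab.
apply/imsetP; exists (finfun f).
  by rewrite inE sf !ffunE lt_f !andbT; apply/injectiveP.
apply/ffunP=> x; have [t ->] := line_surj pq inj_f x.
by apply/val_inj; rewrite /= (confP _ inj_f).2 lab.2.
Qed.
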